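(* Let $N\ge1$ and let $\mathcal{L}=a^N(x)\frac{d^N}{dx^N}+\dots+a^1(x)\frac{d}{dx}+a^0(x)$ on $[-1,1]$ with $a^N(x)\neq0$, where each variable coefficient $a^k$ is (represented by) a finite Chebyshev (for $k=0$) or ultraspherical $C^{(k)}$ (for $k\ge1$) series of degree $m_k$, and let $m=\max_{0\le k\le N}m_k$. Let $A$ be the $n\times n$ Petrov--Galerkin coefficient matrix $A(i,j)=(\psi_i,\mathcal{L}\phi_j)_\omega$, $0\le i,j\le n-1$, with weight $\omega(x)=(1-x^2)^{N-1/2}$ and the trial functions $\phi_j$ and test functions $\psi_i$ described in the context, so that $A=Q^{T}\Omega L R$ with $Q,\Omega,L,R$ as in the context. The matrices $Q$ and $R$ are banded, $\Omega$ is diagonal, and $L$ is banded because all the operators from which it is built are banded. Consequently, for $n\gg m$ the coefficient matrix $A$ is strictly banded, being the sum of products of banded matrices.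
   Context: $T_j$ is the Chebyshev polynomial of the first kind of degree $j$, and $C^{(k)}_j$ is the ultraspherical (Gegenbauer) polynomial of degree $j$ and parameter $k$; the $C^{(N)}_j$ are orthogonal on $[-1,1]$ with respect to $\omega(x)=(1-x^2)^{N-1/2}$, and $(f,g)_\omega=\int_{-1}^1 fg\,\omega\,dx$. $\mathcal{B}_0,\dots,\mathcal{B}_{N-1}$ are the $N$ homogeneous linear constraints (boundary conditions or side constraints) of the problem. The trial functions are $\phi_k=\sum_{j=0}^N\gamma^k_jT_{k+j}$, $0\le k\le n-1$, with $\gamma^k_N\ne0$ and $\mathcal{B}_i\phi_k=0$ for all $i$; $R$ is the matrix of these coefficients, i.e. $(\phi_0|\cdots|\phi_{n-1})=(T_0|\cdots|T_{n+N-1})R$. The test functions are obtained in the same way with $T_{k+j}$ replaced by $C^{(N)}_{k+j}$, $0\le j\le N$, so that they satisfy the same homogeneous constraints (or, if so chosen, the dual boundary conditions); $Q$ is defined by $(\psi_0|\cdots|\psi_{n-1})=(C^{(N)}_0|\cdots|C^{(N)}_{n+N-1})Q$. $\Omega=\operatorname{diag}(d_0,\dots,d_{n+N-1})$ with $d_j=\frac{\pi 2^{1-2N}\Gamma(j+2N)}{j!\,(j+N)[\Gamma(N)]^2}$. $L$ is the leading square truncation, of size matching $Q$ and $R$, of the infinite matrix $\mathcal{M}_N[a^N]\mathcal{D}_N+\sum_{k=0}^{N-1}\mathcal{S}_{N-1}\cdots\mathcal{S}_k\mathcal{M}_k[a^k]\mathcal{D}_k$. Here $\mathcal{D}_0$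 is the identity and, for $k\ge1$, $\mathcal{D}_k$ maps the vector of Chebyshev coefficients of a function to the vector of $C^{(k)}$ coefficients of its $k$th derivative; $\mathcal{M}_k[a]$ represents multiplication by $a$ acting on $C^{(k)}$ coefficients (Chebyshev coefficients when $k=0$); $\mathcal{S}_k$ converts $C^{(k)}$ coefficients (Chebyshev coefficients when $k=0$) to $C^{(k+1)}$ coefficients. *)

(* Defs.v *)
From HB Require Import structures.
From mathcomp Require Import all_boot all_order all_algebra.
From mathcomp Require Import all_classical all_reals all_analysis.
Set Implicit Arguments.
Unset Strict Implicit.
Unset Printing Implicit Defensive.
Import Order.TTheory GRing.Theory Num.Theory numFieldNormedType.Exports.
Local Open Scope classical_set_scope.
Local Open Scope ring_scope.

Section Polynomials.
Variable R : realType.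
Implicit Types (b : nat -> {poly R}) (p q : {poly R}).

Fixpoint cheb (j : nat) : {poly R} :=
  match j with
  | 0 => 1
  | 1 => 'X
  | (i.+1 as i1).+1 => 2 *: ('X * cheb i1) - cheb i
  end.

(* (j + 2) C_{j+2} = 2 (j + 1 + lambda) x C_{j+1} - (j + 2 lambda) C_j *)
Fixpoint gegenbauer (lambda : R) (j : nat) : {poly R} :=
  match j with
  | 0 => 1
  | 1 => (2 * lambda) *: 'X
  | (i.+1 as i1).+1 =>
      (i.+2)%:R^-1 *: ((2 * (i1%:R + lambda)) *: ('X * gegenbauer lambda i1)
                       - (i%:R + 2 * lambda) *: gegenbauer lambda i)
  end.

(* Index 0 stands for the Chebyshev basis, not for the degenerate C^(0). *)
Definition ubasis (k : nat) : nat -> {poly R} :=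
  if k is 0 then cheb else gegenbauer k%:R.

(* Coefficient of b_i in the expansion of p in a basis b such that b_j has
   degree exactly j: the leading terms are eliminated from the top down. *)
Fixpoint bcoef_rec b (d : nat) p (i : nat) : R :=
  if d is e.+1 then
    let c := p`_e / lead_coef (b e) in
    if i == e then c else bcoef_rec b e (p - c *: b e) i
  else 0.

Definition bcoef b p : nat -> R := bcoef_rec b (size p) p.

Lemma bcoefP b p : (forall j, size (b j) = j.+1) ->
  p = \sum_(i < size p) bcoef b p i *: b i.
Proof.
move=> sb; rewrite /bcoef.
suff H d : (size p <= d)%N -> p = \sum_(i < d) bcoef_rec b d p i *: b i.
  exact: H.
elim: d p => [|d IH] p lepd.
  by rewrite big_ord0; apply/eqP; rewrite -size_poly_leq0.
rewrite big_ord_recr /= eqxx; set c := _ / _.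
have lb0 : lead_coef (b d) != 0 by rewrite lead_coef_eq0 -size_poly_eq0 sb.
rewrite (eq_bigr (fun i : 'I_d => bcoef_rec b d (p - c *: b d) i *: b i)).
  rewrite -IH ?subrK //; apply/leq_sizeP => j.
  rewrite leq_eqVlt => /predU1P[<-|ltdj]; rewrite coefB coefZ.
    have -> : (b d)`_d = lead_coef (b d) by rewrite lead_coefE sb.
    by rewrite /c mulfVK ?subrr.
  by rewrite !nth_default ?sb ?mulr0 ?subrr // (leq_trans lepd).
by move=> i _; rewrite ltn_eqF.
Qed.

Definition fseries (k d : nat) (alpha : nat -> R) : {poly R} :=
  \sum_(j < d.+1) alpha j *: ubasis k j.

Definition recombine b (N : nat) (gamma : nat -> nat -> R) (k : nat)
  : {poly R} := \sum_(j < N.+1) gamma k j *: b (k + j)%N.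

Definition diffop (N : nat) (a : nat -> {poly R}) p : {poly R} :=
  \sum_(k < N.+1) a k * p^`(k).

Definition inner (N : nat) p q : R :=
  Rintegral lebesgue_measure `[-1, 1]
    (fun x : R => p.[x] * q.[x] * (1 - x ^+ 2) `^ (N%:R - 2^-1)).

End Polynomials.

Section InfiniteMatrices.
Variable R : realType.

(* Infinite matrices, entry X i j in row i and column j. *)
Definition imx := nat -> nat -> R.

Definition id_imx : imx := fun i j => (i == j)%:R.

(* A sum with finite support whenever the columns of Y are finitely supported,
   as is the case for all the operators below. *)
Definition mul_imx (X Y : imx) : imx :=
  fun i j => \sum_(l \in [set: nat]) X i l * Y l j.

Definition add_imx (X Y : imx) : imx := fun i j => X i j + Y i j.

Definition zero_imx : imx := fun _ _ => 0.

Definition D_imx (k : nat) : imx :=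
  if k is 0 then id_imx
  else fun i j => bcoef (ubasis R k) (cheb R j)^`(k) i.

Definition M_imx (k : nat) (a : {poly R}) : imx :=
  fun i j => bcoef (ubasis R k) (a * ubasis R k j) i.

Definition S_imx (k : nat) : imx :=
  fun i j => bcoef (ubasis R k.+1) (ubasis R k j) i.

(* S_{k+d-1} ... S_{k+1} S_k X *)
Fixpoint convert (k d : nat) (X : imx) : imx :=
  if d is e.+1 then mul_imx (S_imx (k + e)) (convert k e X) else X.

Definition L_imx (N : nat) (a : nat -> {poly R}) : imx :=
  add_imx (mul_imx (M_imx N (a N)) (D_imx N))
    (\big[add_imx/zero_imx]_(k < N)
       convert k (N - k) (mul_imx (M_imx k (a k)) (D_imx k))).

Definition truncate (p : nat) (X : imx) : 'M[R]_p := \matrix_(i, j) X i j.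

Definition banded_imx (b : nat) (X : imx) : Prop :=
  forall i j, (i + b < j)%N || (j + b < i)%N -> X i j = 0.

Definition banded (b p q : nat) (X : 'M[R]_(p, q)) : Prop :=
  forall (i : 'I_p) (j : 'I_q), (i + b < j)%N || (j + b < i)%N -> X i j = 0.

End InfiniteMatrices.

Section Omega.
Variable R : realType.

Definition Gamma (s : R) : R :=
  Rintegral lebesgue_measure `]0, +oo[ (fun t : R => t `^ (s - 1) * expR (- t)).

Definition Omega (N p : nat) : 'M[R]_p :=
  diag_mx (\row_(j < p)
    (pi * 2 `^ (1 - 2 * N%:R) * Gamma (j%:R + 2 * N%:R)
     / (j`!%:R * (j%:R + N%:R) * Gamma N%:R ^+ 2))).

End Omega.

(* Main.v *)
Require Import Defs.
From mathcomp Require Import all_boot all_order all_algebra.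
From mathcomp Require Import all_classical all_reals all_analysis.
From mathcomp Require Import measurable_realfun ring lra zify.
Set Implicit Arguments.
Unset Strict Implicit.
Unset Printing Implicit Defensive.
Import Order.TTheory GRing.Theory Num.Theory numFieldNormedType.Exports.
Local Open Scope ring_scope.

(* Expanding both factors of A(i, j), the factorisation A = Q^T Omega L R says
   that the C^(N)_j are orthogonal with squared norms d_j and that the matrix
   built from the D_k, M_k and S_k computes C^(N) coefficients of L T_j.

   Orthogonality: since N is an integer, the weight is (1 - x^2)^(N-1) times
   sqrt (1 - x^2), so every integral reduces to the linear functional
   p |-> int p sqrt (1 - x^2).  Integrating the derivative of
   p (1 - x^2)^(3/2) makes the Gegenbauer operator symmetric, and its eigenvalues
   -j (j + 2 N) are distinct.  The three-term recurrence gives the ratio of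
   consecutive squared norms, and the base case is int sqrt (1 - x^2) = pi / 2.

   Bandwidths: D_k is supported on one diagonal because the k-th derivative of
   T_j is a multiple of C^(k)_(j-k); S_k is supported on the diagonals 0 and 2;
   M_k[a] is a polynomial of degree deg a in the tridiagonal multiplication by x.
   Bandwidths add up under products. *)

(** * Expansion coefficients in a basis with one polynomial per degree *)

Section Coefficients.
Variable R : realType.
Implicit Types (p q : {poly R}).

Section Basis.
Variable b : nat -> {poly R}.
Hypothesis size_b : forall j, size (b j) = j.+1.

(** Each elimination step reads off a top coefficient and subtracts a multiple of [b e], both linear
    in the polynomial. *)
Lemma bcoef_rec_linear d c p q i :
  bcoef_rec b d (c *: p + q) i = c * bcoef_rec b d p i + bcoef_rec b d q i.
Proof.
elim: d p q => [|d IH] p q /=; first by rewrite mulr0 addr0.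
rewrite coefD coefZ mulrDl -mulrA; case: ifP => // _.
by rewrite -IH; congr bcoef_rec; rewrite scalerDl scalerBr scalerA opprD addrACA.
Qed.

Lemma bcoef_rec_geq d p i : (d <= i)%N -> bcoef_rec b d p i = 0.
Proof.
elim: d p => //= d IH p ltdi.
by rewrite gtn_eqF ?IH // ltnW.
Qed.

(** Steps above the degree subtract zero. Polynomials of different sizes can thus be eliminated from
    a common depth. *)
Lemma bcoef_rec_widen d p i : (size p <= d)%N -> bcoef_rec b d p i = bcoef b p i.
Proof.
rewrite /bcoef => /subnK <-; elim: (d - size p)%N => //= e IH.
rewrite nth_default ?leq_addl// mul0r scale0r subr0 IH; case: eqP => // ->.
by rewrite [RHS]bcoef_rec_geq ?leq_addl.
Qed.

Lemma bcoef_linear c p q i :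
  bcoef b (c *: p + q) i = c * bcoef b p i + bcoef b q i.
Proof.
set d := maxn (size p) (size q).
have sp : (size p <= d)%N by rewrite leq_maxl.
have sq : (size q <= d)%N by rewrite leq_maxr.
have spq : (size (c *: p + q)%R <= d)%N.
  by rewrite (leq_trans (size_polyD _ _))// geq_max sq (leq_trans (size_scale_leq _ _)).
by rewrite -!(bcoef_rec_widen (d := d))// bcoef_rec_linear.
Qed.

Lemma bcoef0 i : bcoef b 0 i = 0.
Proof. by rewrite /bcoef size_poly0. Qed.

Lemma bcoefD p q i : bcoef b (p + q) i = bcoef b p i + bcoef b q i.
Proof. by rewrite -[p in LHS]scale1r bcoef_linear mul1r. Qed.

Lemma bcoefZ c p i : bcoef b (c *: p) i = c * bcoef b p i.
Proof. by rewrite -[c *: p]addr0 bcoef_linear bcoef0 addr0. Qed.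

Lemma bcoef_sum (I : Type) (r : seq I) (P : pred I) (F : I -> {poly R}) i :
  bcoef b (\sum_(k <- r | P k) F k) i = \sum_(k <- r | P k) bcoef b (F k) i.
Proof.
apply: (big_morph (fun p => bcoef b p i)) => [p q|]; [exact: bcoefD | exact: bcoef0].
Qed.

Lemma bcoef_basis i j : bcoef b (b j) i = (i == j)%:R.
Proof.
have lb0 : lead_coef (b j) != 0 by rewrite lead_coef_eq0 -size_poly_eq0 size_b.
rewrite /bcoef size_b /=.
have -> : (b j)`_j = lead_coef (b j) by rewrite lead_coefE size_b.
rewrite divff//; case: eqP => // _; rewrite scale1r subrr.
by rewrite bcoef_rec_widen ?size_poly0 // bcoef0.
Qed.

Lemma bcoef_ge_size p i : (size p <= i)%N -> bcoef b p i = 0.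
Proof.
move=> spi; rewrite [p in LHS](bcoefP p size_b) bcoef_sum big1 // => k _.
rewrite bcoefZ bcoef_basis gtn_eqF ?mulr0 //.
exact: leq_trans (ltn_ord k) spi.
Qed.

Lemma bcoef_expand d p : (size p <= d)%N -> p = \sum_(i < d) bcoef b p i *: b i.
Proof.
move=> spd; rewrite [LHS](bcoefP p size_b) 
  (big_ord_widen d (fun i => bcoef b p i *: b i) spd).
rewrite big_mkcond; apply: eq_bigr => i _; case: ltnP => // /bcoef_ge_size ->.
by rewrite scale0r.
Qed.

End Basis.

(** * Identities between Chebyshev and Gegenbauer polynomials *)

Lemma size_cheb j : size (cheb R j) = j.+1.
Proof.
elim/ltn_ind: j => -[|[|j]] IH /=; [exact: size_poly1 | exact: size_polyX |].
have n0 : cheb R j.+1 != 0 by rewrite -size_poly_eq0 IH.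
have sX : size ('X * cheb R j.+1) = j.+3 by rewrite mulrC size_mulX ?IH.
by rewrite size_polyDl ?size_polyN size_scale ?pnatr_eq0 // sX IH.
Qed.

Lemma gegenbauerE (l : R) j : gegenbauer l j.+2 =
  (j.+2)%:R^-1 *: ((2 * (j.+1%:R + l)) *: ('X * gegenbauer l j.+1)
                       - (j%:R + 2 * l) *: gegenbauer l j).
Proof. by []. Qed.

Lemma size_gegenbauer (l : R) j : 0 < l -> size (gegenbauer l j) = j.+1.
Proof.
move=> l0; elim/ltn_ind: j => -[|[|j]] IH; first exact: size_poly1.
  by rewrite /= size_scale ?size_polyX // mulf_neq0 ?pnatr_eq0 // gt_eqF.
have n0 : gegenbauer l j.+1 != 0 by rewrite -size_poly_eq0 IH.
rewrite gegenbauerE size_scale ?invr_eq0 ?pnatr_eq0 //.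
have c0 : 2 * (j.+1%:R + l) != 0.
  by rewrite mulf_neq0 ?pnatr_eq0 // gt_eqF // ltr_wpDl.
have sX : size ('X * gegenbauer l j.+1) = j.+3 by rewrite mulrC size_mulX ?IH.
have sc := size_scale ('X * gegenbauer l j.+1) c0.
rewrite size_polyDl ?size_polyN sc sX //.
by rewrite (leq_ltn_trans (size_scale_leq _ _)) // IH.
Qed.

Lemma size_ubasis k j : size (ubasis R k j) = j.+1.
Proof. by case: k => [|k]; [exact: size_cheb | rewrite /= size_gegenbauer // ltr0n]. Qed.

Lemma gegenbauer_rec (l : R) j : (j.+2)%:R *: gegenbauer l j.+2 =
  (2 * (j.+1%:R + l)) *: ('X * gegenbauer l j.+1) - (j%:R + 2 * l) *: gegenbauer l j.
Proof. by rewrite gegenbauerE scalerA divff ?scale1r // pnatr_eq0. Qed.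

Section Ladder.
Variable l : R.
Local Notation C := (gegenbauer l).

(** The two relations are proved together: the second at [j.+1] comes from the differentiated
    recurrence and the first at [j]; the first at [j.+1] then uses the new second relation and both
    old ones. *)
Lemma gegenbauer_ladder j :
  'X * (C j.+1)^`() - (C j)^`() = j.+1%:R *: C j.+1 /\
  (C j.+1)^`() - 'X * (C j)^`() = (j%:R + 2 * l) *: C j.
Proof.
elim: j => [|j [IHA IHB]].
  rewrite /= derivZ derivX derivC -!mul_polyC.
  by rewrite !(rmorphD, rmorphM, rmorph1, rmorph0, rmorph_nat) /=; split; ring.
have j1 : (j.+1%:R : R) = j%:R + 1 by rewrite -addn1 natrD.
have j2 : (j.+2%:R : R) = j%:R + 2 by rewrite -addn2 natrD.
have E := gegenbauer_rec l j.
have dE : j.+2%:R *: (C j.+2)^`() = 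
    (2 * (j.+1%:R + l)) *: (C j.+1 + 'X * (C j.+1)^`()) -
    (j%:R + 2 * l) *: (C j)^`().
  by rewrite -derivZ E derivB !derivZ derivM derivX mul1r.
have j20 : j.+2%:R != 0 :> R by rewrite pnatr_eq0.
rewrite j1 j2 in E dE IHA IHB j20 *.
move: E dE IHA IHB j20; move: (j%:R : R) => n.
move: (C j.+2) (C j.+1) (C j) => c2 c1 c0.
move: (c2^`()) (c1^`()) (c0^`()) => d2 d1 d0.
(* Scalars become constant polynomials, so that [ring] applies and [n + 2] can be cancelled in the
   polynomial ring. *)
rewrite -(polyC_eq0 (n + 2)).
rewrite -!mul_polyC !(rmorph_nat, rmorphD, rmorphM, rmorph1) /= => E dE IHA IHB n20.
have B : d2 - 'X * d1 = (n%:P + 1 + 2 * l%:P) * c1.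
  apply: (mulfI n20); rewrite mulrBr dE.
  have -> : d0 = 'X * d1 - (n%:P + 1) * c1 by rewrite -IHA; ring.
  by ring.
split => //.
have -> : d2 = 'X * d1 + (n%:P + 1 + 2 * l%:P) * c1 by rewrite -B; ring.
rewrite E.
have -> : d1 = 'X * d0 + (n%:P + 2 * l%:P) * c0 by rewrite -IHB; ring.
have -> : (2 * (n%:P + 1 + l%:P) * ('X * c1) - (n%:P + 2 * l%:P) * c0) =
  (n%:P + 1 + 2 * l%:P) * ('X * c1) + 'X * ((n%:P + 1) * c1) -
  (n%:P + 2 * l%:P) * c0 by ring.
rewrite -IHA.
have -> : d1 = 'X * d0 + (n%:P + 2 * l%:P) * c0 by rewrite -IHB; ring.
by ring.
Qed.

(** Eliminating [C j.+1] between the ladder relations shows that the derivatives obey the recurrence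
    of parameter [l + 1], shifted by one index. *)
Lemma gegenbauer_deriv_rec j : (j.+1)%:R *: (C j.+2)^`() =
  (2 * (j.+1%:R + l)) *: ('X * (C j.+1)^`()) - (j.+1%:R + 2 * l) *: (C j)^`().
Proof.
have [A _] := gegenbauer_ladder j; have [_ B] := gegenbauer_ladder j.+1.
have -> : (C j.+2)^`() = 'X * (C j.+1)^`() + (j.+1%:R + 2 * l) *: C j.+1.
  by rewrite -B; ring.
rewrite scalerDr scalerA [j.+1%:R * _]mulrC -[_ *: C j.+1]scalerA -A.
move: ((C j.+1)^`()) ((C j)^`()) => d1 d0; rewrite -!mul_polyC.
by rewrite !(rmorph_nat, rmorphD, rmorphM) /=; ring.
Qed.

Lemma gegenbauer_deriv j : (C j.+1)^`() = (2 * l) *: gegenbauer (l + 1) j.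
Proof.
elim/ltn_ind: j => -[|[|j]] IH.
- by rewrite /= derivZ derivX.
(* The factor 1 is the coefficient [j.+1] of the derivative recurrence at [j = 0]. *)
- apply: (@scalerI _ _ (1%:R : R)); first exact: oner_neq0.
  rewrite gegenbauer_deriv_rec IH // derivC scaler0 subr0 /= -scalerAr mulr1 !scalerA.
  by congr (_ *: _); ring.
apply: (@scalerI _ _ (j.+2%:R : R)); first by rewrite pnatr_eq0.
rewrite gegenbauer_deriv_rec !IH //.
have -> p : j.+2%:R *: ((2 * l) *: p) = (2 * l) *: (j.+2%:R *: p) :> {poly R}.
  by rewrite !scalerA mulrC.
rewrite gegenbauer_rec.
rewrite -scalerAr scalerBr !scalerA.
have j1 : (j.+1%:R : R) = j%:R + 1 by rewrite -addn1 natrD.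
have j2 : (j.+2%:R : R) = j%:R + 2 by rewrite -addn2 natrD.
by congr (_ *: _ - _ *: _); rewrite ?j1 ?j2; ring.
Qed.

(** Adding the ladder relations at [j.+1] and [j.+2] writes [C j.+2] through a difference of two
    derivatives, which are Gegenbauer polynomials of parameter [l + 1]. *)
Lemma gegenbauer_convert j : (j.+2%:R + l) *: C j.+2 =
  l *: (gegenbauer (l + 1) j.+2 - gegenbauer (l + 1) j).
Proof.
apply: (@scalerI _ _ (2 : R)); first by rewrite pnatr_eq0.
rewrite [RHS]scalerA scalerBr -!gegenbauer_deriv.
have [A _] := gegenbauer_ladder j.+1; have [_ B] := gegenbauer_ladder j.+2.
have -> : (C j.+3)^`() - (C j.+1)^`() =
    ((C j.+3)^`() - 'X * (C j.+2)^`()) + ('X * (C j.+2)^`() - (C j.+1)^`()).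
  by rewrite addrA subrK.
rewrite A B -scalerDl scalerA.
by congr (_ *: _); ring.
Qed.

(** Differentiating both ladder relations and eliminating the polynomial of lower index leaves a
    second-order equation. *)
Lemma gegenbauer_ode j :
  (1 - 'X ^+ 2) * (C j)^`(2) - (2 * l + 1) *: ('X * (C j)^`())
  = - (j%:R * (j%:R + 2 * l)) *: C j.
Proof.
case: j => [|j].
  by rewrite derivnS derivn1 derivC deriv0 !mulr0 scaler0 subr0 mul0r oppr0 scale0r.
rewrite derivnS derivn1.
have [A B] := gegenbauer_ladder j.
have dA := congr1 (@deriv R) A; have dB := congr1 (@deriv R) B.
move: A B dA dB; rewrite !derivB !derivM !derivZ !derivX !mul1r.
have j1 : (j.+1%:R : R) = j%:R + 1 by rewrite -addn1 natrD.
rewrite j1.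
move: (C j.+1) (C j) => c1 c0; move: (c1^`()) (c0^`()) => d1 d0.
move: (d1^`()) (d0^`()) => e1 e0.
rewrite -!mul_polyC !(rmorph_nat, rmorphD, rmorphM, rmorphN, rmorph1) /=.
move: (j%:R : {poly R}) (l%:P) => n L A B dA dB.
have Hc : (n + 1) * c1 = 'X * d1 - d0 by rewrite A.
have He0 : e0 = d1 + 'X * e1 - (n + 1) * d1 by rewrite -dA; ring.
have He1 : e1 = d0 + 'X * e0 + (n + 2 * L) * d0 by rewrite -dB; ring.
have -> : - ((n + 1) * (n + 1 + 2 * L)) * c1 = - (n + 1 + 2 * L) * ((n + 1) * c1) by ring.
rewrite Hc.
have -> : (1 - 'X ^+ 2) * e1 = e1 - 'X * ('X * e1) by ring.
have Xe1 : 'X * e1 = e0 - d1 + (n + 1) * d1 by rewrite He0; ring.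
rewrite Xe1 {1}He1; ring.
Qed.

End Ladder.

Lemma chebE j : cheb R j.+2 = 2 *: ('X * cheb R j.+1) - cheb R j.
Proof. by []. Qed.

(** At parameter 1 all coefficients share the factor [j.+2]; what remains is the Chebyshev
    recurrence, here for the polynomials of the second kind. *)
Lemma gegenbauer1_rec j :
  gegenbauer 1 j.+2 = 2 *: ('X * gegenbauer 1 j.+1) - gegenbauer (1 : R) j.
Proof.
apply: (@scalerI _ _ (j.+2%:R : R)); first by rewrite pnatr_eq0.
rewrite gegenbauer_rec scalerBr !scalerA.
have j1 : (j.+1%:R : R) = j%:R + 1 by rewrite -addn1 natrD.
have j2 : (j.+2%:R : R) = j%:R + 2 by rewrite -addn2 natrD.
by congr (_ *: _ - _ *: _); rewrite ?j1 ?j2; ring.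
Qed.

(** Both sides satisfy the same constant-coefficient recurrence, so two initial cases suffice. *)
Lemma cheb_convert j : 2 *: cheb R j.+2 = gegenbauer 1 j.+2 - gegenbauer 1 j.
Proof.
elim/ltn_ind: j => -[|[|j]] IH.
- rewrite gegenbauer1_rec chebE /= -!mul_polyC; rewrite !rmorphM rmorph_nat rmorph1; ring.
- rewrite 2!gegenbauer1_rec 2!chebE /= -!mul_polyC.
  rewrite !rmorphM rmorph_nat rmorph1; ring.
have H1 := IH _ (ltnSn j.+1); have H0 := IH _ (ltnW (ltnSn j.+1)).
rewrite chebE scalerBr H0 scalerA -[2 * 2]/(2 * 2 : R) -scalerA.
rewrite scalerAr H1 (gegenbauer1_rec j.+2) {2}(gegenbauer1_rec j) mulrBr scalerBr.
by rewrite !opprD !opprK !addrA; ring.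
Qed.

Lemma cheb_deriv j : (cheb R j.+1)^`() = j.+1%:R *: gegenbauer 1 j.
Proof.
elim/ltn_ind: j => -[|[|j]] IH.
- by rewrite /= derivX scale1r.
- rewrite /= derivB derivZ derivM derivX derivC -!mul_polyC.
  rewrite !rmorphM rmorph_nat rmorph1; ring.
rewrite chebE derivB derivZ derivM derivX mul1r !IH // scalerDr cheb_convert.
rewrite (gegenbauer1_rec j) -scalerAr scalerA.
rewrite -!mul_polyC !(rmorphM, rmorph_nat).
rewrite -[j.+3]addn3 -[j.+2]addn2 -[j.+1]addn1 !natrD; ring.
Qed.

End Coefficients.

(** * The Gamma function at positive integers *)

Section GammaFactorial.
Local Open Scope classical_set_scope.
Local Open Scope ring_scope.
Variable R : realType.

(** From [expR t >= t ^+ n.+1 / n.+1!] the quotient is at most [n.+1! / t]. *)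
Lemma cvg_exprn_expRN n : t ^+ n * expR (- t) @[t --> +oo%R] --> (0 : R).
Proof.
apply/cvgrPdist_le => e e0; near=> t.
have t0 : 0 < t by near: t; apply: nbhs_pinfty_gt; exact: num_real.
rewrite sub0r normrN ger0_norm ?mulr_ge0 ?exprn_ge0 ?expR_ge0 ?(ltW t0) //.
have te : n.+1`!%:R / e <= t by near: t; apply: nbhs_pinfty_ge; exact: num_real.
rewrite expRN ler_pdivrMr ?expR_gt0 //.
have f0 : 0 < n.+1`!%:R :> R by rewrite ltr0n fact_gt0.
have H : t ^+ n.+1 / n.+1`!%:R <= expR t.
  by rewrite (le_trans _ (expR_ge1Dxn n (ltW t0))) // lerDr.
move: te; rewrite ler_pdivrMr // => te.
apply: le_trans (ler_wpM2l (ltW e0) H).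
rewrite exprS !mulrA ler_pdivlMr // mulrC ler_wpM2r ?exprn_ge0 1?mulrC// ltW//.
Unshelve. all: end_near. Qed.

(* [- gamma_poly n * exp (- t)] is an antiderivative of [t ^ n * exp (- t)] *)
Fixpoint gamma_poly (n : nat) : {poly R} :=
  if n is m.+1 then n%:R *: gamma_poly m + 'X^n else 1.

Lemma gamma_poly_deriv n : gamma_poly n - (gamma_poly n)^`() = 'X^n.
Proof.
elim: n => [|n IH]; first by rewrite /= derivC subr0.
rewrite [gamma_poly _]/= derivD derivZ derivXn -[X in _ - (_ + X)]scaler_nat.
by rewrite opprD addrACA -scalerBr IH addrCA subrr addr0.
Qed.

Lemma gamma_poly0 n : (gamma_poly n).[0] = n`!%:R.
Proof.
elim: n => [|n IH]; first by rewrite /= hornerC.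
by rewrite hornerD hornerZ IH hornerXn expr0n addr0 factS natrM.
Qed.

Lemma cvg_gamma_poly n : (gamma_poly n).[t] * expR (- t) @[t --> +oo%R] --> (0 : R).
Proof.
elim: n => [|n IH].
  have := @cvg_exprn_expRN 0; apply: cvg_trans; apply: near_eq_cvg; near=> t.
  by rewrite hornerC expr0.
have : n.+1%:R * ((gamma_poly n).[t] * expR (- t)) + t ^+ n.+1 * expR (- t)
    @[t --> +oo%R] --> n.+1%:R * 0 + (0 : R).
  by apply: cvgD (@cvg_exprn_expRN n.+1); apply: cvgM IH; exact: cvg_cst.
rewrite mulr0 addr0; apply: cvg_trans; apply: near_eq_cvg; near=> t => /=.
by rewrite hornerD hornerZ hornerXn mulrDl mulrA.
Unshelve. all: end_near. Qed.

Lemma Gamma_fact n : Gamma (n.+1%:R : R) = n`!%:R.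
Proof.
rewrite /Gamma.
pose f (t : R) := t ^+ n * expR (- t).
pose F (t : R) := - ((gamma_poly n).[t] * expR (- t)).
have cf : continuous f.
  move=> t; apply: cvgM; first exact: exprn_continuous.
  by apply: continuous_comp; [exact: opp_continuous | exact: continuous_expR].
have dF (t : R) : is_derive t (1 : R) F (f t).
  have dp : is_derive t (1 : R) (horner (gamma_poly n)) (gamma_poly n)^`().[t].
    by rewrite derivE derive1E; apply: DeriveDef => //; exact: derivable_horner.
  rewrite /F.
  apply: is_derive_eq.
  rewrite /f -[t ^+ n]hornerXn -gamma_poly_deriv hornerD hornerN /GRing.scale /=.
  ring.
(* The real power equals [t ^+ n] for positive [t], and adding the endpoint 0 does not change the
   integral. *)
transitivity (\int[lebesgue_measure]_(x in `[0%R, +oo[) f x)%R.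
  rewrite [RHS]/Rintegral -integral_itv_obnd_cbnd; last first.
    by apply/measurable_EFinP; apply: measurable_funTS; exact: continuous_measurable_fun.
  apply: eq_Rintegral => t; rewrite inE /= in_itv /= andbT => t0.
  by rewrite -[n.+1]addn1 natrD addrK powR_mulrn // ltW.
rewrite (@Rintegral_ge0_continuous_FTC2y _ f F 0 0).
- by rewrite /F oppr0 expR0 mulr1 gamma_poly0 opprK add0r.
- by move=> t t0; rewrite mulr_ge0 ?exprn_ge0 ?expR_ge0.
- exact: continuous_subspaceT.
- by rewrite -[0]oppr0; apply: cvgN; exact: cvg_gamma_poly.
- by move=> t _; have [] := dF t.
- apply: cvg_at_right_filter; apply: differentiable_continuous.
  by apply/derivable1_diffP; have [] := dF 0.
- by move=> t _; rewrite derive1E; have [] := dF t.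
Qed.

End GammaFactorial.

(** * Integration of polynomials against sqrt (1 - x^2) *)

Section SqrtWeight.
Local Open Scope classical_set_scope.
Local Open Scope ring_scope.
Variable R : realType.
Implicit Types (p q : {poly R}) (x t : R).
Local Notation w x := (Num.sqrt (1 - x ^+ 2)).

Definition wint p : R := \int[lebesgue_measure]_(x in `[(-1)%R, 1%R]) (p.[x] * w x).

Lemma continuous_weight : continuous (fun x : R => w x).
Proof.
move=> x; apply: (@continuous_comp _ _ _ (fun x : R => 1 - x ^+ 2) Num.sqrt).
  by apply: cvgB; [exact: cvg_cst | exact: exprn_continuous].
exact: sqrt_continuous.
Qed.

Lemma continuous_wpoly p : continuous (fun x : R => p.[x] * w x).
Proof.
by move=> x; apply: cvgM;
  [exact: continuous_horner | exact: continuous_weight].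
Qed.

Lemma integrable_wpoly p :
  lebesgue_measure.-integrable `[(-1)%R, 1%R] (EFin \o (fun x : R => p.[x] * w x)).
Proof.
apply: continuous_compact_integrable; first exact: segment_compact.
exact/continuous_subspaceT/continuous_wpoly.
Qed.

Lemma wint_linear c p q : wint (c *: p + q) = c * wint p + wint q.
Proof.
rewrite /wint -RintegralZl //; last exact: integrable_wpoly.
rewrite -RintegralD //; last exact: integrable_wpoly.
  by apply: eq_Rintegral => x _; rewrite hornerD hornerZ mulrDl mulrA.
have := integrable_wpoly (c *: p); apply: eq_integrable => // x _ /=.
by rewrite hornerZ mulrA.
Qed.

(** The integrand is the derivative of p (1 - x^2)^(3/2), which vanishes at both endpoints. *)
Lemma wint_parts p : wint ((1 - 'X ^+ 2) * p^`() - 3 *: ('X * p)) = 0.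
Proof.
rewrite /wint /Rintegral.
pose F x := ((1 - 'X^2) * p).[x] * w x.
have cF : continuous F by exact: continuous_wpoly.
(* The square root is differentiated only where 1 - x^2 is positive; at the endpoints continuity of
   [F] suffices. *)
have dF x : -1 < x < 1 -> is_derive x (1 : R) F
    (((1 - 'X ^+ 2) * p^`() - 3 *: ('X * p)).[x] * w x).
  move=> /andP[x1 x2].
  have w0 : 0 < 1 - x ^+ 2.
    by rewrite (_ : 1 - x ^+ 2 = (1 - x) * (1 + x)); [nra | ring].
  have dp : is_derive x (1 : R) (horner ((1 - 'X^2) * p)) ((1 - 'X^2) * p)^`().[x].
    by rewrite derivE derive1E; apply: DeriveDef => //; exact: derivable_horner.
  have ds : is_derive x (1 : R) (fun x : R => w x) (- x / w x).
    have dq : is_derive x (1 : R) (fun x : R => 1 - x ^+ 2) (- (2 * x)).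
      by apply: is_derive_eq; rewrite /GRing.scale /=; ring.
    have := @is_derive1_comp _ Num.sqrt (fun x : R => (1 - x ^+ 2 : R)) x _ _
      (is_derive1_sqrt w0) dq.
    move=> H; apply: is_derive_eq.
    by rewrite /GRing.scale /=; field; rewrite gt_eqF ?sqrtr_gt0.
  rewrite /F; apply: is_derive_eq.
  have wn0 : w x != 0 by rewrite gt_eqF // sqrtr_gt0.
  have ww : w x ^+ 2 = 1 - x ^+ 2 by rewrite sqr_sqrtr // ltW.
  rewrite /GRing.scale /= derivM derivB derivXn derivC !hornerE /=.
  have -> : (1 - x ^+ 2) * p.[x] * - x / w x = w x * (- (x * p.[x])).
    by move: (w x) wn0 ww => s sn0 <-; field.
  by ring.
rewrite (@continuous_FTC2 _ _ F) //.
- by rewrite /F sqrrN !expr1n subrr sqrtr0 !mulr0 subee.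
- exact/continuous_subspaceT/continuous_wpoly.
- split; first by move=> x; rewrite in_itv => /dF[].
    by apply: cvg_at_right_filter; exact: cF.
  by apply: cvg_at_left_filter; exact: cF.
- by move=> x; rewrite in_itv /= => /dF[? ?]; rewrite derive1E.
Qed.

(** The substitution x = sin t turns the integral into that of cos^2 over [-pi/2, pi/2]. *)
Lemma wint1 : wint 1 = pi / 2.
Proof.
rewrite /wint /Rintegral.
have h0 : - (pi / 2) < pi / 2 :> R by have := pi_gt0 R; lra.
have sN : sin (- (pi / 2)) = -1 :> R by rewrite sinN sin_pihalf.
have s1 := @sin_pihalf R.
have D : ((@sin R)^`())%classic = cos.
  by apply/funext => x; rewrite derive1E; apply: derive_val.
under eq_integral do rewrite hornerC mul1r.
have := @integration_by_substitution_increasing R sin (fun x => w x)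
  (- (pi / 2)) (pi / 2).
rewrite sN s1 => ->; first last.
- exact/continuous_subspaceT/continuous_weight.
- split.
  + by move=> x _; exact: derivable_sin.
  + by apply: cvg_at_right_filter; exact: continuous_sin.
  + by apply: cvg_at_left_filter; exact: continuous_sin.
- rewrite D; apply/cvg_ex; exists (cos (pi / 2)).
  by apply: cvg_at_left_filter; exact: continuous_cos.
- rewrite D; apply/cvg_ex; exists (cos (- (pi / 2))).
  by apply: cvg_at_right_filter; exact: continuous_cos.
- by move=> x _; rewrite D; exact: continuous_cos.
- by move=> x y xI yI; rewrite ltr_sin.
- exact: ltW.
pose F x := (x + sin x * cos x) / 2.
have dF x : is_derive x (1 : R) F (cos x ^+ 2).
  rewrite /F; apply: is_derive_eq.
  have := cos2Dsin2 x; rewrite /GRing.scale /=; lra.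
have cF : continuous F.
  by move=> x; apply: differentiable_continuous; apply/derivable1_diffP; have [] := dF x.
(* On this interval cos is nonnegative, so the square root of cos^2 is cos itself. *)
under eq_integral => x.
  rewrite inE /= in_itv /= => /cos_ge0_pihalf c0.
  rewrite D /= /GRing.mul /= -cos2sin2 sqrtr_sqr ger0_norm // -expr2.
  over.
rewrite (@continuous_FTC2 _ _ F) //.
- rewrite /F cosN sN s1 cos_pihalf !mulr0 /=; lra.
- apply: continuous_subspaceT => x.
  by apply: (@continuous_comp _ _ _ cos (fun y : R => y ^+ 2));
    [exact: continuous_cos | exact: exprn_continuous].
- split; first by move=> x _; have [] := dF x.
    by apply: cvg_at_right_filter; exact: cF.
  by apply: cvg_at_left_filter; exact: cF.
- by move=> x _; rewrite derive1E; have [] := dF x.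
Qed.

(** For parameter [N.+1] the exponent is N + 1/2, and the integer part of the power is absorbed into
    the polynomial. *)
Lemma inner_wint N p q : inner N.+1 p q = wint (p * q * (1 - 'X ^+ 2) ^+ N).
Proof.
apply: eq_Rintegral => x; rewrite inE /= in_itv /= => /andP[x1 x2].
have w0 : 0 <= 1 - x ^+ 2.
  by rewrite (_ : 1 - x ^+ 2 = (1 - x) * (1 + x)); [nra | ring].
have -> : N.+1%:R - 2^-1 = N%:R + 2^-1 :> R by rewrite -addn1 natrD; lra.
rewrite powRD ?powR_mulrn ?powR12_sqrt //.
  by rewrite mulrA !hornerE.
by rewrite gt_eqF // ltr_wpDl.
Qed.

End SqrtWeight.

(** * Orthogonality and squared norms of the Gegenbauer polynomials *)

Section Orthogonality.
Variable R : realType.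
Implicit Types (p q f g : {poly R}).

Lemma wint0 : wint (0 : {poly R}) = 0.
Proof. by rewrite -[0](subrr 0) -scaleN1r addrC wint_linear mulN1r addNr. Qed.

Section Weight.
Variable N : nat.

Let L p := inner N.+1 p 1.

Lemma inner_mulr1 p q : inner N.+1 p q = L (p * q).
Proof. by rewrite /L !inner_wint mulr1. Qed.

Let L_linear c p q : L (c *: p + q) = c * L p + L q.
Proof. by rewrite /L !inner_wint !mulr1 mulrDl -scalerAl wint_linear. Qed.

Let L0 : L 0 = 0.
Proof. by rewrite /L inner_wint !mul0r wint0. Qed.

Let LD p q : L (p + q) = L p + L q.
Proof. by rewrite -[p in LHS]scale1r L_linear mul1r. Qed.

Let LZ c p : L (c *: p) = c * L p.
Proof. by rewrite -[c *: p]addr0 L_linear L0 addr0. Qed.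

Let LB p q : L (p - q) = L p - L q.
Proof. by rewrite -scaleN1r LD LZ mulN1r. Qed.

Lemma inner_suml (I : finType) (F : I -> {poly R}) (c : I -> R) q :
  inner N.+1 (\sum_i c i *: F i) q = \sum_i c i * inner N.+1 (F i) q.
Proof.
rewrite inner_mulr1 mulr_suml (big_morph L LD L0).
by apply: eq_bigr => i _; rewrite inner_mulr1 -scalerAl LZ.
Qed.

Lemma innerC p q : inner N.+1 p q = inner N.+1 q p.
Proof. by rewrite !inner_mulr1 mulrC. Qed.

(** This is [wint_parts] for (1 - x^2)^N p, that is, the integral of the derivative of p (1 -
    x^2)^(N + 3/2). *)
Lemma inner_parts p :
  inner N.+1 ((1 - 'X ^+ 2) * p^`() - (2 * N.+1%:R + 1) *: ('X * p)) 1 = 0.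
Proof.
rewrite inner_wint mulr1 -[RHS](wint_parts ((1 - 'X ^+ 2) ^+ N * p)); congr wint.
have dv : (1 - 'X ^+ 2) * ((1 - 'X ^+ 2) ^+ N)^`() =
    - (2 * N%:R) *: ('X * (1 - 'X ^+ 2) ^+ N) :> {poly R}.
  rewrite deriv_exp derivB derivXn derivC /= sub0r expr1 -mul_polyC.
  (* The derivative of a power has exponent [N.-1], which is truncated at [N = 0]. *)
  case: (N) => [|M]; first by rewrite !(mulr0n, mulr0, oppr0, polyC0, mul0r).
  rewrite /= [(1 - _) ^+ M.+1]exprS -[_ *+ M.+1]mulr_natr -[_ *+ 2]mulr_natr.
  rewrite rmorphN rmorphM !rmorph_nat. ring.
rewrite derivM mulrDr mulrA dv -!mul_polyC.
rewrite -[N.+1]addn1 natrD !(rmorph_nat, rmorphN, rmorphD, rmorphM, rmorph1) /=.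
ring.
Qed.

(** Integration by parts for f' g moves one derivative of the Gegenbauer operator onto g; the
    resulting form is symmetric in f and g. *)
Lemma inner_green f g :
  inner N.+1 ((1 - 'X ^+ 2) * f^`(2) - (2 * N.+1%:R + 1) *: ('X * f^`())) g =
  - inner N.+1 ((1 - 'X ^+ 2) * f^`()) g^`().
Proof.
apply/eqP; rewrite -addr_eq0; apply/eqP; rewrite !inner_mulr1 -LD.
rewrite -[RHS](inner_parts (f^`() * g)) derivM derivnS derivn1; congr inner.
rewrite -!mul_polyC; ring.
Qed.

Local Notation lambda := (N.+1%:R : R).
Local Notation C := (gegenbauer lambda).

Lemma inner_gegenbauer_neq i j : i != j -> inner N.+1 (C i) (C j) = 0.
Proof.
move=> neq_ij.
have E k l : k%:R * (k%:R + 2 * lambda) * inner N.+1 (C k) (C l) =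
    L ((1 - 'X ^+ 2) * (C k)^`() * (C l)^`()).
  have := inner_green (C k) (C l).
  by rewrite gegenbauer_ode 2!inner_mulr1 -scalerAl LZ mulNr
    -[L (C k * _)]inner_mulr1 => /oppr_inj ->.
have := E j i; rewrite innerC [(1 - 'X ^+ 2) * _ * _]mulrAC -E => /eqP.
rewrite -subr_eq0 -mulrBl mulf_eq0 => /orP[|/eqP //].
(* The difference of eigenvalues factors, and its second factor is positive. *)
have -> : j%:R * (j%:R + 2 * lambda) - i%:R * (i%:R + 2 * lambda) =
  (j%:R - i%:R) * (i%:R + j%:R + 2 * lambda) by ring.
rewrite mulf_eq0 subr_eq0 eqr_nat eq_sym (negPf neq_ij) /=.
by rewrite gt_eqF // ltr_wpDl ?addr_ge0 // mulr_gt0.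
Qed.

Local Notation h j := (inner N.+1 (C j) (C j)).

(** Pair the recurrence for [C j.+1] with [C j.+1]; the term two degrees lower drops out by
    orthogonality. *)
Lemma norm_gegenbauer_up j : j.+1%:R * h j.+1 =
  2 * (j%:R + lambda) * L ('X * C j * C j.+1).
Proof.
case: j => [|j].
  rewrite mul1r inner_mulr1 add0r.
  by rewrite {1}/gegenbauer -scalerAl LZ /= mulr1.
rewrite inner_mulr1 -LZ scalerAl gegenbauer_rec mulrBl LB
  -[(_ *: (_ * _)) * _]scalerAl LZ -[(_ *: C j) * _]scalerAl LZ.
rewrite -[L (C j * _)]inner_mulr1 inner_gegenbauer_neq ?mulr0 ?subr0 //.
by rewrite neq_ltn ltnS leqnSn.
Qed.

(** Pairing the recurrence for [C j.+2] with [C j] gives a second formula for the integral of x C_j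
    C_(j+1), which is then eliminated. *)
Lemma norm_gegenbauer_rec j : (j%:R + 1 + lambda) * (j.+1%:R * h j.+1) =
  (j%:R + lambda) * (j%:R + 2 * lambda) * h j.
Proof.
have E : (j%:R + 2 * lambda) * h j = 2 * (j.+1%:R + lambda) * L ('X * C j * C j.+1).
  have : L (j.+2%:R *: C j.+2 * C j) = 0.
    by rewrite -scalerAl LZ -inner_mulr1 inner_gegenbauer_neq ?mulr0 //
      neq_ltn ltnS leqnSn orbT.
  rewrite gegenbauer_rec mulrBl LB -[(_ *: (_ * _)) * _]scalerAl LZ
    -[(_ *: C j) * _]scalerAl LZ => /eqP.
  by rewrite subr_eq0 inner_mulr1 ['X * C j * _]mulrAC => /eqP <-.
by rewrite norm_gegenbauer_up -[in RHS]mulrA E -[j.+1]addn1 natrD; ring.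
Qed.

End Weight.

(** [inner_parts] at p = x, with x^2 rewritten through 1 - x^2, a factor that raises the parameter
    of the weight by one. *)
Lemma norm0_gegenbauer_rec N : (N%:R + 2) * 2 * inner N.+2 1 (1 : {poly R}) =
  (2 * N%:R + 3) * inner N.+1 1 1.
Proof.
have := @inner_parts N 'X; rewrite derivX mulr1.
have -> : (1 - 'X ^+ 2) - (2 * N.+1%:R + 1) *: ('X * 'X) =
   ((N%:R + 2) * 2) *: (1 - 'X ^+ 2) + (- (2 * N%:R + 3)) *: (1 : {poly R}).
  rewrite -!mul_polyC -[N.+1]addn1 natrD.
  rewrite !(rmorph_nat, rmorphN, rmorphD, rmorphM, rmorph1) /=; ring.
rewrite !inner_wint !mulr1 mulrDl -2![(_ *: _) * _]scalerAl -{1}exprS.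
rewrite wint_linear -[_ *: _]addr0 wint_linear wint0 addr0 mulNr => /eqP.
by rewrite subr_eq0 !mul1r => /eqP.
Qed.

(** The number d_j for parameter [N.+1], with the Gamma values written as factorials. *)
Definition gegenbauer_norm N j : R :=
  pi * (j + N.*2.+1)`!%:R / (2 ^+ N.*2.+1 * j`!%:R * (j + N.+1)%:R * N`!%:R ^+ 2).

Lemma OmegaE N j : pi * 2 `^ (1 - 2 * N.+1%:R) * Gamma (j%:R + 2 * N.+1%:R)
     / (j`!%:R * (j%:R + N.+1%:R) * Gamma N.+1%:R ^+ 2) = gegenbauer_norm N j.
Proof.
have -> : j%:R + 2 * N.+1%:R = (j + N.*2.+1).+1%:R :> R.
  by rewrite -natrM -natrD; congr _%:R; lia.
have -> : 1 - 2 * N.+1%:R = - N.*2.+1%:R :> R.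
  by rewrite -natrM (_ : 2 * N.+1 = N.*2.+1 + 1)%N ?natrD; [ring | lia].
rewrite !Gamma_fact powRN powR_mulrn // /gegenbauer_norm [(j + N.+1)%:R]natrD.
have Nf : N`!%:R != 0 :> R by rewrite pnatr_eq0 -lt0n fact_gt0.
have jf : j`!%:R != 0 :> R by rewrite pnatr_eq0 -lt0n fact_gt0.
have jN : j%:R + N.+1%:R != 0 :> R by rewrite -natrD pnatr_eq0 addnS.
have p2 : 2 ^+ N.*2.+1 != 0 :> R by rewrite expf_neq0 // pnatr_eq0.
move: (N`!%:R) (j`!%:R) (j%:R + N.+1%:R) (2 ^+ N.*2.+1) Nf jf jN p2 => a b c d.
by move=> a0 b0 c0 d0; field; rewrite a0 b0 c0 d0.
Qed.

Lemma inner_gegenbauer_diag N j :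
  inner N.+1 (gegenbauer N.+1%:R j) (gegenbauer N.+1%:R j) = gegenbauer_norm N j.
Proof.
elim: j => [|j IH]; last first.
  have := norm_gegenbauer_rec N j; rewrite IH.
  have c0 : (j%:R + 1 + N.+1%:R) * j.+1%:R != 0 :> R.
    by rewrite natr1 -natrD -natrM pnatr_eq0.
  rewrite mulrA => E; apply: (mulfI c0); rewrite E /gegenbauer_norm.
  have -> : (j.+1 + N.*2.+1)`!%:R = (j%:R + 2 * N.+1%:R) * (j + N.*2.+1)`!%:R :> R.
    by rewrite addSn factS natrM -[2 * _]natrM -natrD; congr (_%:R * _); lia.
  have -> : (j.+1 + N.+1)%:R = j%:R + 1 + N.+1%:R :> R by rewrite natrD -natr1.
  rewrite factS natrM -[j.+1%:R]natr1 [(j + N.+1)%:R]natrD.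
  have Nf : N`!%:R != 0 :> R by rewrite pnatr_eq0 -lt0n fact_gt0.
  have jf : j`!%:R != 0 :> R by rewrite pnatr_eq0 -lt0n fact_gt0.
  have p2 : 2 ^+ N.*2.+1 != 0 :> R by rewrite expf_neq0 // pnatr_eq0.
  have j1 : j%:R + 1 != 0 :> R by rewrite natr1 pnatr_eq0.
  have jN : j%:R + N.+1%:R != 0 :> R by rewrite -natrD pnatr_eq0 addnS.
  have jN1 : j%:R + 1 + N.+1%:R != 0 :> R by rewrite natr1 -natrD pnatr_eq0.
  move: (N.+1%:R : R) (2 ^+ _) ((j + _)`!%:R) (N`!%:R) (j`!%:R) p2 Nf jf jN jN1.
  move=> n s u v w s0 v0 w0 jN jN1.
  by field; rewrite s0 v0 w0 j1 jN jN1.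
(* For [j = 0] a second induction, on the parameter, descends to the integral of sqrt (1 - x^2). *)
rewrite /gegenbauer_norm add0n /=; elim: N => [|N IH].
  by rewrite inner_wint !mulr1 wint1 fact0 expr1n; field.
have := norm0_gegenbauer_rec N; rewrite IH => E.
have c0 : (N%:R + 2) * 2 != 0 :> R by rewrite -natrD -natrM pnatr_eq0 addn2.
apply: (mulfI c0); rewrite E.
have Nf : N`!%:R != 0 :> R by rewrite pnatr_eq0 -lt0n fact_gt0.
have p2 : 2 ^+ N.*2.+1 != 0 :> R by rewrite expf_neq0 // pnatr_eq0.
have N1 : N%:R + 1 != 0 :> R by rewrite natr1 pnatr_eq0.
have N2 : N%:R + 2 != 0 :> R by rewrite -natrD pnatr_eq0 addn2.
have -> : (N.+1.*2.+1)`!%:R = (2 * N%:R + 3) * (2 * (N%:R + 1)) * (N.*2.+1)`!%:R :> R.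
  rewrite doubleS 2!factS !natrM mulrA; congr (_ * _ * _).
    by rewrite -natrM -natrD; congr _%:R; lia.
  by rewrite natr1 -natrM; congr _%:R; lia.
have -> : 2 ^+ N.+1.*2.+1 = 4 * 2 ^+ N.*2.+1 :> R.
  by rewrite doubleS -[N.*2.+3]/(2 + N.*2.+1)%N exprD; congr (_ * _); ring.
rewrite (factS N) natrM !add0n fact0 -[N.+1%:R]natr1 -[N.+2]addn2 natrD.
move: (2 ^+ _) ((N.*2.+1)`!%:R) (N`!%:R) p2 Nf => s u v s0 v0.
by field; rewrite v0 N1 N2 s0.
Qed.

Lemma inner_gegenbauer N i j :
  inner N.+1 (gegenbauer N.+1%:R i) (gegenbauer N.+1%:R j) =
  gegenbauer_norm N i *+ (i == j).
Proof.
have [<-|neq_ij] := eqVneq i j; first exact: inner_gegenbauer_diag.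
exact: inner_gegenbauer_neq.
Qed.

End Orthogonality.

(** * Sparse relations between the ultraspherical bases *)

Section UltrasphericalRelations.
Variable R : realType.
Implicit Types (p : {poly R}).

(** The first derivative leads to parameter 1, and each further one raises the parameter by one. The
    constant stays existential because bandwidths depend only on the support. *)
Lemma cheb_derivn k j :
  exists c, (cheb R (j + k.+1)%N)^`(k.+1) = c *: gegenbauer k.+1%:R j.
Proof.
elim: k j => [|k IH] j; first by exists j.+1%:R; rewrite addn1 derivn1 cheb_deriv.
have [c E] := IH j.+1; exists (c * (2 * k.+1%:R)).
by rewrite -addSnnS derivnS E derivZ gegenbauer_deriv scalerA natr1.
Qed.

Lemma mulX_ubasis0 k : exists c, 'X * ubasis R k 0 = c *: ubasis R k 1.
Proof.
case: k => [|k] /=; first by exists 1; rewrite mulr1 scale1r.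
exists (2 * k.+1%:R)^-1; rewrite mulr1 scalerA mulVf ?scale1r //.
Qed.

Lemma mulX_ubasis k j : exists c d,
  'X * ubasis R k j.+1 = c *: ubasis R k j.+2 + d *: ubasis R k j.
Proof.
case: k => [|k].
  exists 2^-1, 2^-1; apply: (@scalerI _ _ (2 : R)); first by rewrite pnatr_eq0.
  by rewrite scalerDr !scalerA divff ?pnatr_eq0 // !scale1r [ubasis _ _ j.+2]chebE subrK.
set l : R := k.+1%:R; set u := 2 * (j.+1%:R + l).
have u0 : u != 0 by rewrite mulf_neq0 ?pnatr_eq0 // -natrD pnatr_eq0.
have := gegenbauer_rec l j; rewrite -[ubasis R k.+1]/(gegenbauer l) -/u.
move: (gegenbauer l j.+2) (gegenbauer l j.+1) (gegenbauer l j) => c2 c1 c0 E.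
exists (u^-1 * j.+2%:R), (u^-1 * (j%:R + 2 * l)).
by apply: (scalerI u0); rewrite scalerDr !scalerA !mulVKf // E subrK.
Qed.

Lemma ubasis_convert k j : exists c d,
  ubasis R k j = c *: ubasis R k.+1 j + d *: ubasis R k.+1 j.-2.
Proof.
case: j => [|[|j]].
(* For [j] below 2 the index [j.-2] is truncated to 0, and its coefficient is taken to be 0. *)
- exists 1, 0; rewrite scale0r addr0 scale1r; by case: k.
- case: k => [|k].
    exists 2^-1, 0; rewrite scale0r addr0 /= scalerA mulr1 mulVf ?scale1r //.
  exists (k.+1%:R / k.+2%:R), 0; rewrite scale0r addr0 /= scalerA.
  by congr (_ *: _); rewrite mulrCA mulfVK // pnatr_eq0.
- case: k => [|k].
    exists 2^-1, (- 2^-1); apply: (@scalerI _ _ (2 : R)); first by rewrite pnatr_eq0.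
    rewrite -[ubasis R 0]/(cheb R) cheb_convert scaleNr -scalerBr scalerA.
    by rewrite divff ?pnatr_eq0 // scale1r.
  set l : R := k.+1%:R; set u := j.+2%:R + l.
  have u0 : u != 0 by rewrite /u /l -natrD pnatr_eq0.
  have := gegenbauer_convert l j; rewrite -/u.
  rewrite -[ubasis R k.+1]/(gegenbauer l) -[ubasis R k.+2]/(gegenbauer _) /l natr1.
  move: (gegenbauer l j.+2) (gegenbauer k.+2%:R j.+2) (gegenbauer k.+2%:R j) => c b0 b1 E.
  exists (u^-1 * l), (- (u^-1 * l)); apply: (scalerI u0).
  by rewrite E scaleNr -scalerBr [RHS]scalerA mulVKf.
Qed.

(** This degree bound is what ties the bandwidth of [M_imx] to the length of the coefficient
    series. *)
Lemma size_fseries k d (alpha : nat -> R) : (size (fseries k d alpha) <= d.+1)%N.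
Proof.
apply: (leq_trans (size_sum _ _ _)); apply/bigmax_leqP => i _.
by rewrite (leq_trans (size_scale_leq _ _)) // size_ubasis.
Qed.

End UltrasphericalRelations.

(** * Bandwidths of the operators *)

Section Bands.
Local Open Scope classical_set_scope.
Local Open Scope ring_scope.
Variable R : realType.
Implicit Types (p : {poly R}) (X Y : imx R).

Lemma banded_imxW b c X : banded_imx b X -> (b <= c)%N -> banded_imx c X.
Proof. by move=> bX bc i j ij; apply: bX; lia. Qed.

Lemma bandedW b c (p q : nat) (X : 'M[R]_(p, q)) : banded b X -> (b <= c)%N -> banded c X.
Proof. by move=> bX bc i j ij; apply: bX; lia. Qed.

(** Triangle inequality on indices: outside the band, each term has a vanishing factor. *)
Lemma banded_mul_imx b c X Y :
  banded_imx b X -> banded_imx c Y -> banded_imx (b + c) (mul_imx X Y).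
Proof.
move=> bX bY i j ij; apply: fsbig1 => l _.
have [il|il] := boolP ((i + b < l)%N || (l + b < i)%N); first by rewrite bX ?mul0r.
by rewrite bY ?mulr0 //; lia.
Qed.

Lemma banded_add_imx b X Y :
  banded_imx b X -> banded_imx b Y -> banded_imx b (add_imx X Y).
Proof. by move=> bX bY i j ij; rewrite /add_imx bX ?bY ?addr0. Qed.

Lemma banded_mulmx b c (p q r : nat) (X : 'M[R]_(p, q)) (Y : 'M[R]_(q, r)) :
  banded b X -> banded c Y -> banded (b + c) (X *m Y).
Proof.
move=> bX bY i j ij; rewrite mxE big1 // => l _.
have [il|il] := boolP ((i + b < l)%N || (l + b < i)%N); first by rewrite bX ?mul0r.
by rewrite bY ?mulr0 //; lia.
Qed.

Lemma banded_trmx b (p q : nat) (X : 'M[R]_(p, q)) : banded b X -> banded b X^T.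
Proof. by move=> bX i j ij; rewrite mxE bX // orbC. Qed.

Lemma banded_diag (p : nat) (d : 'rV[R]_p) : banded 0 (diag_mx d).
Proof.
move=> i j ij; rewrite mxE (_ : (i == j) = false) //.
by apply/eqP => E; move: ij; rewrite E; lia.
Qed.

Lemma banded_truncate b (p : nat) X : banded_imx b X -> banded b (truncate p X).
Proof. by move=> bX i j ij; rewrite mxE bX. Qed.

(** Brings the separately defined case [k = 0] under the general formula. *)
Lemma D_imxE k i j : D_imx R k i j = bcoef (ubasis R k) (cheb R j)^`(k) i.
Proof. by case: k => //; rewrite /D_imx derivn0 (bcoef_basis (@size_cheb R)). Qed.

Lemma banded_D_imx N k : (k <= N)%N -> banded_imx N (D_imx R k).
Proof.
case: k => [|k] kN i j ij.
  by rewrite /D_imx /id_imx; have -> : (i == j) = false by lia.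
rewrite D_imxE; have [jk|kj] := ltnP j k.+1.
  by rewrite derivn_poly0 ?size_cheb // bcoef0.
rewrite -(subnK kj); have [c ->] := cheb_derivn R k (j - k.+1).
rewrite bcoefZ (bcoef_basis (size_ubasis R k.+1)).
by have -> : (i == j - k.+1)%N = false; [lia | rewrite mulr0].
Qed.

Lemma banded_S_imx k : banded_imx 2 (S_imx R k).
Proof.
move=> i j ij; rewrite /S_imx; have [c [d ->]] := ubasis_convert R k j.
rewrite bcoefD !bcoefZ !(bcoef_basis (size_ubasis R k.+1)).
have [-> ->] : (i == j) = false /\ (i == j.-2) = false by lia.
by rewrite !mulr0 addr0.
Qed.

Lemma bcoef_mulX k l i : (i + 1 < l)%N || (l + 1 < i)%N ->
  bcoef (ubasis R k) ('X * ubasis R k l) i = 0.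
Proof.
move=> il; have sb := size_ubasis R k.
case: l il => [|l] il.
  have [c ->] := mulX_ubasis0 R k; rewrite bcoefZ (bcoef_basis sb).
  by have -> : (i == 1)%N = false; [lia | rewrite mulr0].
have [c [d ->]] := mulX_ubasis R k l.
rewrite bcoefD !bcoefZ !(bcoef_basis sb).
have [-> ->] : (i == l.+2) = false /\ (i == l) = false by lia.
by rewrite !mulr0 addr0.
Qed.

(** Each factor ['X] moves a basis index by at most one. *)
Lemma bcoef_mulXn k d j i : (i + d < j)%N || (j + d < i)%N ->
  bcoef (ubasis R k) ('X^d * ubasis R k j) i = 0.
Proof.
have sb := size_ubasis R k.
elim: d i => [|d IH] i ij.
  by rewrite expr0 mul1r (bcoef_basis sb); have -> : (i == j) = false by lia.
rewrite exprS -mulrA (bcoefP ('X^d * ubasis R k j) sb) mulr_sumr bcoef_sum big1 // => l _.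
rewrite -scalerAr bcoefZ.
have [lj|lj] := boolP ((l + d < j)%N || (j + d < l)%N); first by rewrite IH ?mul0r.
by rewrite bcoef_mulX ?mulr0 //; lia.
Qed.

(** Here [a] is expanded in monomials, whatever basis its series was given in. *)
Lemma banded_M_imx k d (a : {poly R}) :
  (size a <= d.+1)%N -> banded_imx d (M_imx k a : imx R).
Proof.
move=> sa i j ij; rewrite /M_imx -[a]coefK poly_def mulr_suml bcoef_sum big1 // => l _.
rewrite -scalerAl bcoefZ bcoef_mulXn ?mulr0 //.
have := ltn_ord l; lia.
Qed.

Lemma banded_convert b k d X :
  banded_imx b X -> banded_imx (2 * d + b) (convert k d X).
Proof.
move=> bX; elim: d => [|d IH] //=.
apply: (banded_imxW (banded_mul_imx (@banded_S_imx _) IH)); lia.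
Qed.

Lemma banded_L_imx N m (a : nat -> {poly R}) :
  (forall k, (k <= N)%N -> banded_imx m (M_imx k (a k))) ->
  banded_imx (m + 3 * N) (L_imx N a).
Proof.
move=> bM.
have bMD k : (k <= N)%N -> banded_imx (m + N) (mul_imx (M_imx k (a k)) (D_imx R k)).
  by move=> kN; apply: banded_mul_imx; [exact: bM | exact: banded_D_imx].
apply: banded_add_imx; first by apply: (banded_imxW (bMD N _)); lia.
elim/big_ind: _ => [||k _]; [by [] | exact: banded_add_imx |].
have kN := ltn_ord k.
(* The width is 2 (N - k) + m + N, at most m + 3 N. *)
have H := @banded_convert (m + N) k (N - k) _ (bMD k (ltnW kN)).
by refine (banded_imxW H _); lia.
Qed.

End Bands.

(** * The infinite matrix as the differential operator in coefficients *)

Section OperatorMatrix.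
Local Open Scope classical_set_scope.
Local Open Scope ring_scope.
Variable R : realType.
Implicit Types (p : {poly R}) (X Y : imx R).

(** One statement for both operators: [b' = b] gives multiplication, [a = 1] gives conversion. The
    sum is finite because the coefficients of [p] vanish from [size p] on. *)
Lemma fsum_bcoef (b b' : nat -> {poly R}) (a p : {poly R}) (i : nat) :
  (forall j, size (b j) = j.+1) -> (forall j, size (b' j) = j.+1) ->
  \sum_(l \in [set: nat]) bcoef b' (a * b l) i * bcoef b p l = bcoef b' (a * p) i.
Proof.
move=> sb sb'.
rewrite -(@fsbig_widen _ _ _ _ `I_(size p)) //; last first.
  by move=> l [_ /negP]; rewrite -leqNgt => pl; rewrite /= (bcoef_ge_size sb pl) mulr0.
rewrite -fsbig_ord [p in RHS](bcoefP p sb) mulr_sumr bcoef_sum.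
by apply: eq_bigr => l _; rewrite -scalerAr bcoefZ mulrC.
Qed.

Lemma MD_imxE k (a : {poly R}) i j : mul_imx (M_imx k a) (D_imx R k) i j =
  bcoef (ubasis R k) (a * (cheb R j)^`(k)) i.
Proof.
rewrite -(fsum_bcoef a (cheb R j)^`(k) i (size_ubasis R k) (size_ubasis R k)).
by apply: eq_fsbigr => l _; rewrite D_imxE.
Qed.

(** Conversion changes the basis but not the polynomial [P j] that column [j] represents. *)
Lemma convertE k d X (P : nat -> {poly R}) :
  (forall i j, X i j = bcoef (ubasis R k) (P j) i) ->
  forall i j, convert k d X i j = bcoef (ubasis R (k + d)) (P j) i.
Proof.
move=> XE; elim: d => [|d IH] i j /=; first by rewrite addn0.
rewrite addnS -[P j in RHS]mul1r.
rewrite -(fsum_bcoef 1 (P j) i (size_ubasis R (k + d)) (size_ubasis R (k + d).+1)).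
by apply: eq_fsbigr => l _; rewrite IH mul1r.
Qed.

Lemma L_imxE N (a : nat -> {poly R}) i j :
  L_imx N a i j = bcoef (ubasis R N) (diffop N a (cheb R j)) i.
Proof.
rewrite /L_imx /add_imx MD_imxE /diffop big_ord_recr /= bcoefD addrC; congr (_ + _).
rewrite bcoef_sum (big_morph (fun X : imx R => X i j) (id1 := 0) (op1 := +%R)) //.
apply: eq_bigr => k _; rewrite (convertE _ (@MD_imxE k (a k))) subnKC //.
exact: ltnW.
Qed.

Lemma diffop_sum N (a : nat -> {poly R}) (I : finType) (c : I -> R) (F : I -> {poly R}) :
  diffop N a (\sum_i c i *: F i) = \sum_i c i *: diffop N a (F i).
Proof.
rewrite /diffop (eq_bigr (fun k : 'I_N.+1 => \sum_i c i *: (a k * (F i)^`(k)))).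
  by rewrite exchange_big /=; apply: eq_bigr => i _; rewrite scaler_sumr.
move=> k _; rewrite linear_sum mulr_sumr; apply: eq_bigr => i _.
by rewrite /= derivnZ -scalerAr.
Qed.

Lemma inner_bcoef N p i : inner N.+1 (ubasis R N.+1 i) p =
  gegenbauer_norm R N i * bcoef (ubasis R N.+1) p i.
Proof.
have sb := size_ubasis R N.+1.
(* The expansion is made long enough to contain index [i], even beyond the degree of [p]. *)
set d := maxn (size p) i.+1.
have id : (i < d)%N by rewrite leq_max leqnn orbT.
rewrite [p in LHS](bcoef_expand sb (leq_maxl (size p) i.+1)) innerC inner_suml.
rewrite (bigD1 (Ordinal id)) //= inner_gegenbauer eqxx mulr1n mulrC.
rewrite big1 ?addr0 // => j ji.
by rewrite inner_gegenbauer (_ : (_ == i) = false) ?mulr0n ?mulr0 //; apply/negbTE.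
Qed.

Lemma recombine_expand (b f : nat -> {poly R}) (n p : nat)
    (X : 'M[R]_(p, n)) :
  \row_(k < n) f k = \row_(q < p) b q *m map_mx polyC X ->
  forall k : 'I_n, f k = \sum_(q < p) X q k *: b q.
Proof.
move=> /matrixP E k; have := E 0 k; rewrite !mxE => ->.
by apply: eq_bigr => q _; rewrite !mxE mulrC mul_polyC.
Qed.

(** Coefficients are unique, so a column of [X] can be read off from [recombine], whose indices run
    from [k] to [k + N]. *)
Lemma banded_recombine (b : nat -> {poly R}) (N n p : nat)
    (gamma : nat -> nat -> R) (X : 'M[R]_(p, n)) :
  (forall j, size (b j) = j.+1) ->
  (forall k : 'I_n, recombine b N gamma k = \sum_(q < p) X q k *: b q) ->
  banded N X.
Proof.
move=> sb E q k qk.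
have := congr1 (fun f => bcoef b f q) (E k).
rewrite /recombine !bcoef_sum (bigD1 q) //= bcoefZ bcoef_basis // eqxx mulr1.
rewrite [X in _ = _ + X -> _]big1 => [|i iq]; last first.
  by rewrite bcoefZ bcoef_basis // eq_sym (_ : (_ == _) = false) ?mulr0 //; apply/negbTE.
rewrite addr0 => <-; rewrite big1 // => j _.
rewrite bcoefZ bcoef_basis // (_ : (_ == _) = false) ?mulr0 //.
have := ltn_ord j; lia.
Qed.

End OperatorMatrix.

(** * Factorisation and bandwidth of the Petrov-Galerkin matrix *)

Theorem mainTheorem2 (R : realType) (N : nat) (hN : (0 < N)%N) :
  (* c depends on N only: all the bandwidths below are independent of n *)
  exists c : nat,
  forall (deg : nat -> nat) (alpha : nat -> nat -> R),
  let m := (\max_(k < N.+1) deg k)%N in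
  let a := fun k : nat => fseries k (deg k) (alpha k) in
  (forall x : R, -1 <= x <= 1 -> (a N).[x] != 0) ->
  (forall k, (k <= N)%N ->
     banded_imx c (D_imx R k) /\ banded_imx (m + c) (M_imx k (a k))) /\
  (forall k, (k < N)%N -> banded_imx c (S_imx R k)) /\
  forall (B Bt : 'I_N -> {scalar {poly R}}) (gamma delta : nat -> nat -> R)
    (n : nat),
  let phi := recombine (cheb R) N gamma in
  let psi := recombine (ubasis R N) N delta in
  (forall k, (k < n)%N -> gamma k N != 0 /\ delta k N != 0) ->
  (forall (i : 'I_N) k, (k < n)%N -> B i (phi k) = 0 /\ Bt i (psi k) = 0) ->
  forall Rmx Qmx : 'M[R]_(n + N, n),
  \row_(k < n) phi k = \row_(p < n + N) cheb R p *m map_mx polyC Rmx ->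
  \row_(k < n) psi k = \row_(p < n + N) ubasis R N p *m map_mx polyC Qmx ->
  let A : 'M[R]_n :=
    \matrix_(i, j) inner N (psi i) (diffop N a (phi j)) in
  let L : 'M[R]_(n + N) := truncate (n + N) (L_imx N a) in
  A = Qmx^T *m Omega R N (n + N) *m L *m Rmx /\
  banded c Qmx /\ banded c Rmx /\ is_diag_mx (Omega R N (n + N)) /\
  banded (m + c) L /\ banded (m + c) A.
Proof.
case: N hN => // N _.
(* With [N.+1] as the order, the widest matrix is [A]: one order each from [Qmx] and [Rmx], three
   from [L]. *)
exists (5 * N.+1)%N => deg alpha m a _.
have bM k : (k <= N.+1)%N -> banded_imx m (M_imx k (a k)).
  move=> kN; apply: (banded_imxW (banded_M_imx k (size_fseries k (deg k) (alpha k)))).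
  exact: (@leq_bigmax _ (fun i : 'I_N.+2 => deg i) (Ordinal (kN : (k < N.+2)%N))).
split=> [k kN|].
  split; first by apply: (banded_imxW (banded_D_imx R kN)); lia.
  by apply: (banded_imxW (bM k kN)); lia.
split=> [k kN|]; first by apply: (banded_imxW (@banded_S_imx R k)); lia.
move=> B Bt gamma delta n phi psi _ _ Rmx Qmx.
move=> /recombine_expand phiE /recombine_expand psiE A L.
have bR : banded N.+1 Rmx := banded_recombine (@size_cheb R) phiE.
have bQ : banded N.+1 Qmx := banded_recombine (size_ubasis R N.+1) psiE.
have bL : banded (m + 3 * N.+1) L by apply: banded_truncate; exact: banded_L_imx.
have AE : A = Qmx^T *m Omega R N.+1 (n + N.+1) *m L *m Rmx.
  (* Expanding [psi i] gives the sum over [q]; orthogonality then yields the diagonal entry times a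
     coefficient of the operator applied to [phi j], and expanding [phi j] gives the product of [L]
     and [Rmx]. *)
  apply/matrixP => i j; rewrite -!mulmxA mul_diag_mx [LHS]mxE [RHS]mxE.
  rewrite psiE inner_suml; apply: eq_bigr => q _.
  rewrite inner_bcoef phiE diffop_sum bcoef_sum !mxE OmegaE; congr (_ * (_ * _)).
  by apply: eq_bigr => p _; rewrite bcoefZ !mxE L_imxE mulrC.
split=> //; split; first by apply: (bandedW bQ); lia.
split; first by apply: (bandedW bR); lia.
split; first exact: diag_mx_is_diag.
split; first by apply: (bandedW bL); lia.
rewrite AE.
have bQO : banded (N.+1 + 0) (Qmx^T *m Omega R N.+1 (n + N.+1)).
  exact: banded_mulmx (banded_trmx bQ) (@banded_diag _ _ _).
by apply: (bandedW (banded_mulmx (banded_mulmx bQO bL) bR)); lia.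
Qed.
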